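(* The greedy algorithm provides an $O(\log K)$ approximation in polynomial time for the path length restricted version of MSP. That is, it runs in time polynomial in the number of fibers and outputs a survivable path set whose size is at most $O(\log K)\cdot\xi$, where $\xi$ is the minimum size of a survivable path set.
   Context: A layered network consists of a physical topology, a finite graph $G_P=(V_P,E_P)$ whose $m$ links are called fibers, and a logical topology, a finite graph $G_L=(V_L,E_L)$ with $V_L\subseteq V_P$, together with a lightpath routing that maps each logical link $(i,j)\in E_L$ to an $i$-$j$ path in $G_P$. Let $s\neq t$ be two nodes of $V_L$. A logical path is an $s$-$t$ path in $G_L$; it uses a fiber if some logical link on it is routed over that fiber, and it survives a fiber if it does not use it. A set of logical $s$-$t$ paths is survivable if for every fiber at least one path of the set survives that fiber. The MSP problem is to find a survivable path set of minimum cardinality. In the path length restricted version only logical $s$-$t$ paths that use at most $K$ fibers are admissible, where $K$ is a fixed constant for the running time (the constant hidden in the approximation factor $O(\log K)$ is absolute, with $K\ge 2$). Only instances admitting a survivable path set are considered. Greedy algorithm: the input is the set of all admissible paths, with the set of fibers used by each path, and the set of all fibers. In the first iteration it selects a path using the minimum number of fibers (equivalently, surviving the maximum number of fibers) and records the set of fibers not survived by it. In each following iteration it selects a path that survives the maximum number of the fibers not yet survived by any previously selected path, and updates the set of unsurvived fibers. It stops when every fiber is survived by some selected path, and outputs the selected paths. *)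

(* Defs.v *)
From HB Require Import structures.
From mathcomp Require Import all_boot all_order all_algebra.
From mathcomp Require Import reals exp.

Set Implicit Arguments.
Unset Strict Implicit.
Unset Printing Implicit Defensive.

(* The graphs are finite, simple and undirected.  Both topologies live on the
   same vertex type, the vertex set of the physical topology; the nodes of the
   logical topology form a subset of it. *)

(* As in path.v, a path from x to y is given by the sequence p of the vertices
   that follow x; paths do not repeat vertices. *)
Definition upath (T : eqType) (e : rel T) (x y : T) (p : seq T) : bool :=
  [&& path e x p, last x p == y & uniq (x :: p)].

(* A logical link {i, j} carries a single lightpath, which is read from i to j
   or from j to i; hence the condition [lightpath_rev]. *)
Record network := Network {
  node :> finType;
  phys : rel node;
  phys_sym : symmetric phys;
  phys_irr : irreflexive phys;
  lnode : {set node};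
  llink : rel node;
  llink_sym : symmetric llink;
  llink_irr : irreflexive llink;
  llink_lnode : forall i j, llink i j -> (i \in lnode) && (j \in lnode);
  lightpath : node -> node -> seq node;
  lightpath_upath : forall i j, llink i j -> upath phys i j (lightpath i j);
  lightpath_rev : forall i j,
    llink i j -> i :: lightpath i j = rev (j :: lightpath j i)
}.

Record instance := Instance {
  net :> network;
  src : net;
  dst : net;
  src_lnode : src \in lnode net;
  dst_lnode : dst \in lnode net;
  src_neq_dst : src != dst
}.

Definition fiber (N : network) := {set N}.

Definition fibers (N : network) : {set fiber N} :=
  [set f | [exists x, exists y, phys x y && (f == [set x; y])]].

Definition lightpath_fibers (N : network) (i j : N) : seq (fiber N) :=
  pairmap (fun x y => [set x; y]) i (lightpath i j).

Section Problem.

Variables (I : instance) (K : nat).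

Definition logical_path (p : seq I) : bool := upath (@llink I) (src I) (dst I) p.

Definition uses (p : seq I) (f : fiber I) : bool :=
  has (fun l => f \in lightpath_fibers l.1 l.2) (pairmap pair (src I) p).

Definition survives (p : seq I) (f : fiber I) : bool := ~~ uses p f.

Definition used (p : seq I) : {set fiber I} := [set f in fibers I | uses p f].

Definition admissible (p : seq I) : bool := logical_path p && (#|used p| <= K).

(* Sets of paths are represented by duplicate-free sequences. *)
Definition survivable_path_set (P : seq (seq I)) : Prop :=
  [/\ uniq P, {in P, forall p, admissible p}
    & {in fibers I, forall f, exists2 p, p \in P & survives p f}].

Definition min_survivable_size (xi : nat) : Prop :=
  (exists2 P, survivable_path_set P & size P = xi) /\
  forall P, survivable_path_set P -> xi <= size P.

(* [greedy_rest U sel]: starting from the set U of the fibers not survived so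
   far, the later iterations may select the sequence sel.  Ties are broken
   arbitrarily, so there can be several such sequences. *)
Inductive greedy_rest (U : {set fiber I}) : seq (seq I) -> Prop :=
| GreedyStop : U = set0 -> greedy_rest U [::]
| GreedyStep p sel :
    U != set0 ->
    admissible p ->
    (forall q, admissible q ->
       #|[set f in U | survives q f]| <= #|[set f in U | survives p f]|) ->
    greedy_rest [set f in U | ~~ survives p f] sel ->
    greedy_rest U (p :: sel).

(* When there is no fiber, the stopping condition holds from the start (and
   there is no path to select). *)
Definition greedy_run (sel : seq (seq I)) : Prop :=
  if sel is p :: sel' then
    [/\ fibers I != set0, admissible p,
        forall q, admissible q -> #|used p| <= #|used q|
      & greedy_rest (used p) sel']
  else fibers I = set0.

(* The input of the algorithm: the fibers and the admissible paths, listed in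
   an arbitrary order, each path with the list of the fibers it uses. *)
Definition greedy_input (fs : seq (fiber I))
    (ps : seq (seq I * seq (fiber I))) : Prop :=
  [/\ uniq fs, fs =i fibers I, uniq (unzip1 ps), unzip1 ps =i admissible
    & forall x, x \in ps -> uniq x.2 /\ x.2 =i used x.1].

End Problem.

(* Cost model: a computation returns its result with its running time.  Every
   call of a recursive function is charged one unit, and between two calls
   only a bounded number of constructors, pattern matchings and comparisons of
   two fiber names take place; natural numbers are handled in unary. *)
Definition timed (A : Type) : Type := A * nat.

Definition ret {A : Type} (x : A) : timed A := (x, 0).

Definition bind {A B : Type} (c : timed A) (k : A -> timed B) : timed B :=
  let: (x, m) := c in let: (y, n) := k x in (y, m + n).

Definition tick {A : Type} (c : timed A) : timed A := (c.1, c.2.+1).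

Definition result {A : Type} (c : timed A) : A := c.1.

Definition time {A : Type} (c : timed A) : nat := c.2.

Notation "'let*' x := c 'in' k" := (bind c (fun x => k))
  (at level 200, x name, c at level 200, k at level 200).

Section Algorithm.

Variables (F : eqType) (T : Type).

Fixpoint ltn_timed (m n : nat) : timed bool :=
  tick (match m, n with
        | _, 0 => ret false
        | 0, _.+1 => ret true
        | m'.+1, n'.+1 => ltn_timed m' n'
        end).

Fixpoint mem_timed (f : F) (s : seq F) : timed bool :=
  tick (if s is g :: s' then
          if f == g then ret true else mem_timed f s'
        else ret false).

Fixpoint size_timed (s : seq F) : timed nat :=
  tick (if s is _ :: s' then let* n := size_timed s' in ret n.+1 else ret 0).

Fixpoint count_survived (U s : seq F) : timed nat :=
  tick (if U is f :: U' then
          let* b := mem_timed f s in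
          let* n := count_survived U' s in
          ret (if b then n else n.+1)
        else ret 0).

Fixpoint unsurvived (U s : seq F) : timed (seq F) :=
  tick (if U is f :: U' then
          let* b := mem_timed f s in
          let* r := unsurvived U' s in
          ret (if b then f :: r else r)
        else ret [::]).

(* Scans ps for a value that beats that of the current candidate x. *)
Fixpoint select (val : seq F -> timed nat) (better : nat -> nat -> timed bool)
    (x : T * seq F) (v : nat) (ps : seq (T * seq F)) : timed (T * seq F) :=
  tick (if ps is y :: ps' then
          let* w := val y.2 in
          let* b := better w v in
          if b then select val better y w ps' else select val better x v ps'
        else ret x).

(* The list n bounds the number of iterations; it makes the loop a structural
   recursion. *)
Fixpoint greedy_loop (n : seq F) (ps : seq (T * seq F)) (U : seq F) :
    timed (seq T) :=
  tick (match U, n, ps with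
        | _ :: _, _ :: n', x :: ps' =>
            let* v := count_survived U x.2 in
            let* y := select (count_survived U) (fun w v => ltn_timed v w)
                      x v ps' in
            let* U' := unsurvived U y.2 in
            let* sel := greedy_loop n' ps U' in
            ret (y.1 :: sel)
        | _, _, _ => ret [::]
        end).

Definition greedy (fs : seq F) (ps : seq (T * seq F)) : timed (seq T) :=
  tick (match fs, ps with
        | _ :: _, x :: ps' =>
            let* v := size_timed x.2 in
            let* y := select size_timed ltn_timed x v ps' in
            let* sel := greedy_loop fs ps y.2 in
            ret (y.1 :: sel)
        | _, _ => ret [::]
        end).

End Algorithm.

(* Main.v *)
Require Import Defs.
From mathcomp Require Import all_boot all_order all_algebra.
From mathcomp Require Import reals exp.
From mathcomp Require Import ring lra zify.

Set Implicit Arguments.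
Unset Strict Implicit.
Unset Printing Implicit Defensive.

Import Order.TTheory GRing.Theory Num.Theory.

(** The greedy rule is the greedy heuristic for set cover, where a path covers
    the fibers that it survives.  The gain over the usual logarithm of the
    number of fibers comes from the first selection: an admissible path uses at
    most [K] fibers, so that only [K] elements are left to cover afterwards.

    Approximation factor.  Let [xi] paths survive all fibers.  Whatever set [U]
    is left, one of them survives at least [#|U| / xi] of its fibers
    ([card_le_survivable]), so the selected path removes [b >= #|U| / xi]
    fibers.  As [ln #|U| - ln (#|U| - b) >= b / #|U| >= 1 / xi], each iteration
    is paid for by the decrease of [xi * ln #|U|], except the one that empties
    [U], which costs at most [xi] more ([greedy_rest_size]).  Hence at most
    [1 + xi * (1 + ln K)] paths are selected, and [K >= 2] lets the factor
    [1 + 2 / ln 2] absorb the constants ([greedy_run_size]).  The same averaging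
    shows that each iteration makes progress, so that the selected paths are
    distinct ([greedy_rest_sound]) and the loop stops in time
    ([greedy_loop_rest]).

    Running time.  The procedures are polynomial in the number [m] of fibers and
    in the number of admissible paths, so what matters is that the latter is
    polynomial in [m] ([count_admissible]).  Each vertex of a logical path other
    than its source is the end of a nonempty lightpath, hence of a used fiber;
    at most [K] used fibers have at most [2 * K] ends.  An admissible path is
    thus a word of length at most [2 * K] over the at most [2 * m] ends of
    fibers, whence at most [(2 * m + 1) ^ (2 * K)] such paths. *)

(** * Counting admissible paths *)

Lemma mem_path_pairmap (T S : eqType) (e : rel T) (f : T -> T -> S) x p y :
  path e x p -> y \in p -> exists2 u, e u y & f u y \in pairmap f x p.
Proof.
elim: p x => //= z p IHp x /andP[exz zp]; rewrite inE => /predU1P[->|yp].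
  by exists x => //; rewrite mem_head.
by have [u euy fuy] := IHp z zp yp; exists u => //; rewrite inE fuy orbT.
Qed.

(** Padding with [None] turns a word of length at most [d] into a function from
    ['I_d] to the alphabet extended by one letter, which gives the base
    [#|A|.+1]. *)
Lemma size_bounded_words (T : finType) (A : {set T}) d (s : seq (seq T)) :
  uniq s -> (forall p, p \in s -> size p <= d /\ {subset p <= A}) ->
  size s <= #|A|.+1 ^ d.
Proof.
move=> s_uniq sA.
pose B : {set option T} := None |: Some @: A.
pose enc (p : seq T) : {ffun 'I_d -> option T} :=
  [ffun i : 'I_d => nth None (map Some p) i].
have enc_inj : {in s &, injective enc}.
  move=> p q /sA[pd _] /sA[qd _] /ffunP eq_pq.
  apply: (@inj_map _ _ Some); first by move=> x y [].
  have out (r : seq T) i : size r <= i -> nth None (map Some r) i = None.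
    by move=> ri; rewrite nth_default ?size_map.
  have eq_nth i : nth None (map Some p) i = nth None (map Some q) i.
    have [lt_id|le_di] := ltnP i d; last by rewrite !out ?(leq_trans _ le_di).
    by have := eq_pq (Ordinal lt_id); rewrite !ffunE.
  have lt_size (r r' : seq T) :
      (forall i, nth None (map Some r) i = nth None (map Some r') i) ->
      size r <= size r'.
    move=> eq_r; rewrite leqNgt; apply/negP => lt_r'r.
    by have := eq_r (size r'); rewrite (out r') //;
       case: r lt_r'r {eq_r} => // a r lt; rewrite (nth_map a).
  apply: (@eq_from_nth _ None) => [|i _]; last exact: eq_nth.
  by rewrite !size_map; apply/eqP; rewrite eqn_leq !lt_size.
rewrite -(size_map enc).
have <- : #|@ffun_on 'I_d B| = #|A|.+1 ^ d.
  rewrite card_ffun_on card_ord cardsU1 card_imset; last exact: Some_inj.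
  by case: imsetP => // -[].
have uniq_enc : uniq (map enc s) by rewrite map_inj_in_uniq.
rewrite -(card_uniqP uniq_enc); apply/subset_leq_card/subsetP => _ /mapP[p ps ->].
apply/ffun_onP => i; rewrite ffunE; have [_ pA] := sA p ps.
have [lt_ip|le_pi] := ltnP i (size p); last first.
  by rewrite nth_default ?size_map // setU11.
case: p lt_ip pA {ps} => // a p lt_ip pA.
by rewrite (nth_map a) // setU1r ?imset_f ?pA ?mem_nth.
Qed.

Section Network.

Variables (I : instance) (K : nat).
Implicit Types (sel P : seq (seq I)) (p : seq I) (S U : {set fiber I}).

Lemma card_cover_fibers S : S \subset fibers I -> #|cover S| <= 2 * #|S|.
Proof.
move=> /subsetP sSI; apply: leq_trans (leq_card_cover S) _.
rewrite mulnC -sum_nat_const; apply: leq_sum => f /sSI.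
rewrite inE => /existsP[x /existsP[y /andP[_ /eqP->]]].
by rewrite cards2; case: (_ != _).
Qed.

Lemma used_sub p : used p \subset fibers I.
Proof. by apply/subsetP => f; rewrite inE => /andP[]. Qed.

(** A vertex of the path is the last vertex of the lightpath of the link that
    enters it.  That lightpath is nonempty, as links are not loops, so the
    vertex is an end of its last fiber. *)
Lemma logical_path_sub_cover p :
  logical_path p -> {subset p <= cover (used p)}.
Proof.
case/and3P=> p_path _ _ y yp.
have [u luy uy] := mem_path_pairmap pair p_path yp.
case/and3P: (lightpath_upath luy) => lp_path /eqP lp_last _.
have y_lp : y \in lightpath u y.
  case: (lightpath u y) lp_last => [/= uy'|z r <-]; last by rewrite /= mem_last.
  by move: luy; rewrite uy' llink_irr.
have [v pvy fvy] := mem_path_pairmap (fun a b => [set a; b]) lp_path y_lp.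
apply/bigcupP; exists [set v; y]; last by rewrite !inE eqxx orbT.
rewrite !inE; apply/andP; split.
  by apply/existsP; exists v; apply/existsP; exists y; rewrite pvy /=.
by apply/hasP; exists (u, y).
Qed.

Lemma size_admissible p : admissible K p -> size p <= 2 * K.
Proof.
case/andP=> p_path used_K; have /and3P[_ _ /=/andP[_ p_uniq]] := p_path.
rewrite -(card_uniqP p_uniq).
apply: leq_trans (subset_leq_card _) _; first exact/subsetP/logical_path_sub_cover.
apply: leq_trans (card_cover_fibers (used_sub p)) _.
by rewrite leq_mul2l used_K orbT.
Qed.

Lemma count_admissible (ps : seq (seq I)) :
  uniq ps -> {subset ps <= admissible K} ->
  size ps <= (2 * #|fibers I|).+1 ^ (2 * K).
Proof.
move=> ps_uniq ps_adm.
apply: (@leq_trans (#|cover (fibers I)|.+1 ^ (2 * K))); last first.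
  have := card_cover_fibers (subxx (fibers I)).
  by case: (2 * K) => // n le; rewrite leq_exp2r.
apply: size_bounded_words => // p /ps_adm p_adm.
split; first exact: size_admissible.
case/andP: p_adm => /logical_path_sub_cover p_sub _ x /p_sub /bigcupP[f fp xf].
by apply/bigcupP; exists f => //; apply: (subsetP (used_sub p)).
Qed.

(** * Approximation factor *)

(** Averaging: each fiber of [U] is survived by one of the [size P] paths of [P],
    so if no admissible path survives more than [b] fibers of [U], counting the
    pairs of a path of [P] and a fiber of [U] that it survives bounds [#|U|]. *)
Lemma card_le_survivable (P : seq (seq I)) U b :
  survivable_path_set K P -> U \subset fibers I ->
  (forall q, admissible K q -> #|[set f in U | survives q f]| <= b) ->
  #|U| <= size P * b.
Proof.
case=> _ P_adm P_surv /subsetP UI le_b.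
apply: (@leq_trans (\sum_(q <- P) #|[set f in U | survives q f]|)); last first.
  rewrite -sum1_size big_distrl /= big_seq [leqRHS]big_seq.
  by apply: leq_sum => q /P_adm/le_b; rewrite mul1n.
under eq_bigr do rewrite -sum1dep_card big_mkcondr.
rewrite exchange_big /= -sum1_card; apply: leq_sum => f /UI/P_surv[q qP qf].
by rewrite (big_rem q) //= qf.
Qed.

(** The last conclusion is what makes the induction yield [uniq]: the paths
    selected after [p] each survive a fiber that [p] does not, and so differ from
    [p].  It holds because by averaging an optimal choice survives some fiber of
    a nonempty [U]. *)
Lemma greedy_rest_sound (P : seq (seq I)) U sel :
    survivable_path_set K P -> greedy_rest K U sel -> U \subset fibers I ->
  [/\ uniq sel, {in sel, forall p, admissible K p},
      {in U, forall f, exists2 p, p \in sel & survives p f}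
    & {in sel, forall p, exists2 f, f \in U & survives p f}].
Proof.
move=> P_surv; elim=> {U sel} [U ->|U p sel U0 p_adm p_max _ IH] UI.
  by split=> // f; rewrite inE.
have [|sel_uniq sel_adm sel_surv sel_new] := IH.
  by apply: subset_trans UI; apply/subsetP => f; rewrite inE => /andP[].
split.
- rewrite /= sel_uniq andbT; apply/negP => /sel_new[f].
  by rewrite inE => /andP[_ /negP].
- by move=> q; rewrite inE => /predU1P[->|/sel_adm].
- move=> f fU; have [pf|npf] := boolP (survives p f).
    by exists p; rewrite ?mem_head.
  have [|q q_sel qf] := sel_surv f; first by rewrite inE fU.
  by exists q; rewrite // inE q_sel orbT.
- move=> q; rewrite inE => /predU1P[->|/sel_new[f]]; last first.
    by rewrite inE => /andP[fU _]; exists f.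
  have := card_le_survivable P_surv UI p_max.
  have [->|[f]] := set_0Vmem [set f in U | survives p f].
    by rewrite cards0 muln0 leqn0 cards_eq0 (negbTE U0).
  by rewrite inE => /andP[fU pf] _; exists f.
Qed.

Lemma greedy_run_sound P (sel : seq (seq I)) :
  survivable_path_set K P -> greedy_run K sel -> survivable_path_set K sel.
Proof.
move=> P_surv; case: sel => [I0|p sel [I0 p_adm _ rest]].
  by split=> // f; rewrite I0 inE.
have [sel_uniq sel_adm sel_surv sel_new] :=
  greedy_rest_sound P_surv rest (used_sub p).
split.
- rewrite /= sel_uniq andbT; apply/negP => /sel_new[f].
  by rewrite inE /survives => /andP[_ ->].
- by move=> q; rewrite inE => /predU1P[->|/sel_adm].
- move=> f fI; have [pf|] := boolP (survives p f).
    by exists p; rewrite ?mem_head.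
  rewrite negbK => pf; have [|q q_sel qf] := sel_surv f; first by rewrite inE fI.
  by exists q; rewrite // inE q_sel orbT.
Qed.

Lemma greedy_rest0 (sel : seq (seq I)) : greedy_rest K set0 sel -> sel = [::].
Proof.
move E: set0 => U rest; case: rest E => [//|p sel' U0 _ _ _ E].
by rewrite -E eqxx in U0.
Qed.

Local Open Scope ring_scope.

(** The right-hand side is a potential: by [ln (1 + x) <= x], an iteration that
    does not empty [U] decreases it by at least one, and the one that empties
    [U] is paid by the summand [1]. *)
Lemma greedy_rest_size (R : realType) (P : seq (seq I)) U sel :
    survivable_path_set K P -> greedy_rest K U sel -> U \subset fibers I ->
    U != set0 ->
  (size sel)%:R <= (size P)%:R * (1 + ln #|U|%:R) :> R.
Proof.
move=> P_surv; elim=> {U sel} [U ->|U p sel U0 p_adm p_max rest IH] UI.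
  by rewrite eqxx.
move=> _; set W := [set f in U | ~~ survives p f] in rest IH.
have P_gt0 : (0 < size P)%N.
  have [f /(subsetP UI) fI] := set0Pn _ U0.
  by case: P_surv => _ _ /(_ f fI)[q]; case: (P).
have WU : W \subset U by apply/subsetP => f; rewrite inE => /andP[].
pose b := #|[set f in U | survives p f]|.
have cardU : (#|U| = b + #|W|)%N.
  rewrite -(cardsID [set f in U | survives p f] U); congr (_ + _)%N.
    by apply: eq_card => f; rewrite !inE andbA andbb.
  by apply: eq_card => f; rewrite !inE; case: (f \in U); rewrite ?andbT ?andbF.
have := card_le_survivable P_surv UI p_max; rewrite -/b => le_Ub.
have U_gt0 : (0 < #|U|)%N by rewrite card_gt0.
have U1 : 1 <= #|U|%:R :> R by rewrite (ler_nat R 1).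
have P1 : 1 <= (size P)%:R :> R by rewrite (ler_nat R 1).
have [W0|Wn0] := eqVneq W set0.
  move: rest; rewrite W0 => /greedy_rest0 ->.
  have := ln_ge0 U1 => lnU /=; nra.
have W_gt0 : 0 < #|W|%:R :> R by rewrite ltr0n card_gt0.
have {IH} := IH (subset_trans WU UI) Wn0.
have Ub : #|U|%:R = b%:R + #|W|%:R :> R by rewrite -natrD -cardU.
have le_UbR : #|U|%:R <= (size P)%:R * b%:R :> R by rewrite -natrM ler_nat.
have b_ge0 : 0 <= b%:R :> R by [].
have ln_step : ln #|W|%:R - ln #|U|%:R <= - (b%:R / #|U|%:R) :> R.
  rewrite -ln_div ?posrE //; last by rewrite ltr0n.
  have -> : #|W|%:R / #|U|%:R = 1 + - (b%:R / #|U|%:R) :> R.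
    by rewrite Ub; field; rewrite -Ub pnatr_eq0 -lt0n.
  apply: le_ln1Dx; rewrite ltrN2 ltr_pdivrMr ?ltr0n // mul1r Ub; lra.
have le1 : 1 <= (size P)%:R * (b%:R / #|U|%:R) :> R.
  by rewrite mulrA ler_pdivlMr ?ltr0n // mul1r.
rewrite /= -natr1 => IH; nra.
Qed.

(** The first path leaves at most [K] fibers, whence at most
    [1 + size P * (1 + ln K)] paths.  Since [size P >= 1], this is at most
    [size P * (2 + ln K)], and [2 <= (2 / ln 2) * ln K] as [K >= 2]. *)
Lemma greedy_run_size (R : realType) P (sel : seq (seq I)) :
    (2 <= K)%N -> survivable_path_set K P -> greedy_run K sel ->
  (size sel)%:R <= (1 + 2 / ln 2) * ln K%:R * (size P)%:R :> R.
Proof.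
move=> K2 P_surv.
have ln2 : 0 < ln 2 :> R by rewrite ln_gt0 // ltr1n.
have lnK : ln 2 <= ln K%:R :> R.
  by rewrite ler_ln ?posrE ?ltr0n ?ler_nat // (leq_trans _ K2).
have c0 : 0 <= 1 + 2 / ln 2 :> R by rewrite addr_ge0 // divr_ge0 // ltW.
case: sel => [_|p sel [I0 p_adm _ rest]] /=.
  by rewrite mulr_ge0 // mulr_ge0 // ltW // (lt_le_trans ln2).
have P1 : 1 <= (size P)%:R :> R.
  have [f fI] := set0Pn _ I0; rewrite (ler_nat R 1).
  by case: P_surv => _ _ /(_ f fI)[q]; case: (P).
have le2 : 2 <= 2 / ln 2 * ln K%:R :> R.
  by rewrite mulrAC ler_pdivlMr // ler_pM2l.
suff : (size sel)%:R <= (size P)%:R * (1 + ln K%:R) :> R by rewrite -natr1; nra.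
have [U0|Un0] := eqVneq (used p) set0.
  move: rest; rewrite U0 => /greedy_rest0 ->.
  by rewrite mulr_ge0 // addr_ge0 // ltW // (lt_le_trans ln2).
apply: le_trans (greedy_rest_size R P_surv rest (used_sub p) Un0) _.
rewrite ler_wpM2l // lerD2l ler_ln ?posrE ?ltr0n ?card_gt0 ?(leq_trans _ K2) //.
by rewrite ler_nat; case/andP: p_adm.
Qed.

End Network.

(** * Results and running times of the procedures *)

(* The equations [timedE] apply to folded costs only. *)
Local Arguments tick : simpl never.
Local Arguments result : simpl never.
Local Arguments time : simpl never.
Local Arguments bind : simpl never.

Lemma result_bind (A B : Type) (c : timed A) (k : A -> timed B) :
  result (bind c k) = result (k (result c)).
Proof. by case: c => a m; rewrite /bind /=; case: (k a). Qed.

Lemma time_bind (A B : Type) (c : timed A) (k : A -> timed B) :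
  time (bind c k) = time c + time (k (result c)).
Proof. by case: c => a m; rewrite /bind /=; case: (k a). Qed.

Lemma result_tick (A : Type) (c : timed A) : result (tick c) = result c.
Proof. by []. Qed.

Lemma time_tick (A : Type) (c : timed A) : time (tick c) = (time c).+1.
Proof. by []. Qed.

Lemma result_ret (A : Type) (x : A) : result (ret x) = x.
Proof. by []. Qed.

Lemma time_ret (A : Type) (x : A) : time (ret x) = 0.
Proof. by []. Qed.

Definition timedE :=
  (result_ret, time_ret, result_bind, time_bind, result_tick, time_tick).

Lemma result_ltn_timed m n : result (ltn_timed m n) = (m < n).
Proof. by elim: m n => [|m IHm] [|n] //=; rewrite result_tick IHm. Qed.

Lemma time_ltn_timed m n : time (ltn_timed m n) = (minn m n).+1.
Proof. by elim: m n => [|m IHm] [|n] //=; rewrite time_tick IHm minnSS. Qed.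

Section Lists.

Variable F : eqType.
Implicit Types (f : F) (s U : seq F).

Lemma result_mem_timed f s : result (mem_timed f s) = (f \in s).
Proof. by elim: s => //= g s IHs; rewrite inE result_tick; case: (f == g). Qed.

Lemma time_mem_timed f s : time (mem_timed f s) <= (size s).+1.
Proof. by elim: s => //= g s IHs; rewrite time_tick; case: (f == g). Qed.

Lemma result_size_timed s : result (size_timed s) = size s.
Proof. by elim: s => //= f s IHs; rewrite !timedE IHs. Qed.

Lemma time_size_timed s : time (size_timed s) = (size s).+1.
Proof. by elim: s => //= f s IHs; rewrite !timedE IHs addn0. Qed.

Lemma result_count_survived U s :
  result (count_survived U s) = count [predC s] U.
Proof.
elim: U => //= f U IHU; rewrite !timedE result_mem_timed IHU.
by case: (f \in s).
Qed.

Lemma time_count_survived U s :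
  time (count_survived U s) <= size U * (size s).+2 + 1.
Proof.
elim: U => //= f U IHU; rewrite !timedE /=.
by have := time_mem_timed f s; rewrite mulSn; lia.
Qed.

Lemma result_unsurvived U s : result (unsurvived U s) = [seq f <- U | f \in s].
Proof.
elim: U => //= f U IHU; rewrite !timedE result_mem_timed IHU.
by case: (f \in s).
Qed.

Lemma time_unsurvived U s : time (unsurvived U s) <= size U * (size s).+2 + 1.
Proof.
elim: U => //= f U IHU; rewrite !timedE /=.
by have := time_mem_timed f s; rewrite mulSn; lia.
Qed.

End Lists.

Section Select.

Variables (F : eqType) (T : eqType).
Variables (val : seq F -> timed nat) (better : nat -> nat -> timed bool).
Implicit Types (x : T * seq F) (ps : seq (T * seq F)).

Lemma select_mem x v ps : result (select val better x v ps) \in x :: ps.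
Proof.
elim: ps x v => [|y ps IHps] x v; first by rewrite mem_head.
rewrite /= !timedE; case: ifP => _; first by rewrite inE IHps orbT.
by have := IHps x v; rewrite !inE => /orP[->|->]; rewrite ?orbT.
Qed.

(** The comparison [better] keeps the current candidate on ties, so it has to be
    the negation of a total preorder on the values; [leq] yields a minimum and
    [geq] a maximum. *)
Lemma select_best (le : rel nat) x ps :
    reflexive le -> transitive le -> total le ->
    (forall w v, result (better w v) = ~~ le v w) ->
  let y := result (select val better x (result (val x.2)) ps) in
  forall z, z \in x :: ps -> le (result (val y.2)) (result (val z.2)).
Proof.
move=> le_refl le_trans le_total betterE.
elim: ps x => [|y ps IHps] x; first by move=> /= z; rewrite inE => /eqP->.
rewrite /= !timedE betterE; case: ifPn => [nle_xy|].
  have le_yx : le (result (val y.2)) (result (val x.2)).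
    by case/orP: (le_total (result (val y.2)) (result (val x.2))) => // le_xy;
       rewrite le_xy in nle_xy.
  move=> z; rewrite inE => /predU1P[->|]; last exact: IHps.
  by apply: le_trans le_yx; apply: IHps; rewrite mem_head.
rewrite negbK => le_xy z; rewrite !inE => /or3P[/eqP->|/eqP->|z_ps].
- by apply: IHps; rewrite mem_head.
- by apply: le_trans le_xy; apply: IHps; rewrite mem_head.
- by apply: IHps; rewrite inE z_ps orbT.
Qed.

Lemma time_select b x v ps :
    (forall y, y \in ps -> forall v,
       time (val y.2) + time (better (result (val y.2)) v) <= b) ->
  time (select val better x v ps) <= size ps * b.+1 + 1.
Proof.
elim: ps x v => //= y ps IHps x v le_b; rewrite !timedE.
have {}IHps x' v' : time (select val better x' v' ps) <= size ps * b.+1 + 1.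
  by apply: IHps => z z_ps; apply: le_b; rewrite inE z_ps orbT.
have := le_b y (mem_head _ _) v; rewrite mulSn.
case: ifP => _; [have := IHps y (result (val y.2)) | have := IHps x v]; lia.
Qed.

End Select.

(* Stated for a variable list, so that rewriting does not unfold the procedures
   that recurse on it. *)
Lemma greedy_loop_cons (F T : eqType) (g : F) n U (x : T * seq F) ps :
  0 < size U ->
  greedy_loop (g :: n) (x :: ps) U =
  tick (let* v := count_survived U x.2 in
        let* y := select (count_survived U) (fun w v => ltn_timed v w)
                    x v ps in
        let* U' := unsurvived U y.2 in
        let* sel := greedy_loop n (x :: ps) U' in
        ret (y.1 :: sel)).
Proof. by case: U. Qed.

Lemma greedy_cons (F T : eqType) (fs : seq F) (x : T * seq F) ps :
  0 < size fs ->
  greedy fs (x :: ps) =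
  tick (let* v := size_timed x.2 in
        let* y := select (@size_timed F) ltn_timed x v ps in
        let* sel := greedy_loop fs (x :: ps) y.2 in
        ret (y.1 :: sel)).
Proof. by case: fs. Qed.

(** Counting or filtering the unsurvived fibers costs at most
    [m * m.+2 + 1]; an iteration does so for the first candidate and for the
    final update, and for each other candidate it adds a comparison. *)
Definition iteration_cost m N : nat :=
  2 * (m * m.+2 + 1) + (N * (m * m.+2 + m + 3) + 1).

Definition greedy_cost m N : nat :=
  (m.+1).*2 + (N * (m.+1).*2.+1 + 1) + (m * (iteration_cost m N).+1 + 1) + 1.

Section Time.

Variables (F : eqType) (T : eqType) (m : nat) (ps : seq (T * seq F)).
Hypothesis ps_m : forall x, x \in ps -> size x.2 <= m.

Lemma time_greedy_loop (n U : seq F) : size U <= m ->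
  time (greedy_loop n ps U) <= size n * (iteration_cost m (size ps)).+1 + 1.
Proof.
elim: n U => [|g n IHn] V V_m; first by case: V V_m.
have [/size0nil->|V_gt0] := posnP (size V); first by rewrite addn1.
case ps_eq: ps => [|x ps']; first by case: (V) => *; rewrite addn1.
rewrite greedy_loop_cons // -ps_eq.
have x_ps : x \in ps by rewrite ps_eq mem_head.
rewrite !timedE; set y := result (select _ _ _ _ _).
set U' := result (unsurvived _ _).
have y_ps : y \in ps by rewrite ps_eq select_mem.
have scan z : z \in ps -> size V * (size z.2).+2 + 1 <= m * m.+2 + 1.
  by move=> /ps_m z_m; rewrite leq_add2r leq_mul.
have U'_m : size U' <= m.
  by rewrite /U' result_unsurvived size_filter (leq_trans (count_size _ _)).
have {IHn} := IHn U' U'_m.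
have := leq_trans (time_count_survived V x.2) (scan x x_ps).
have := leq_trans (time_unsurvived V y.2) (scan y y_ps).
have : time (select (count_survived V) (fun w v => ltn_timed v w) x
   (result (count_survived V x.2)) ps') <= size ps' * (m * m.+2 + m + 2).+1 + 1.
  apply: time_select => z z_ps' v.
  have z_ps : z \in ps by rewrite ps_eq inE z_ps' orbT.
  have := leq_trans (time_count_survived V z.2) (scan z z_ps).
  rewrite time_ltn_timed result_count_survived.
  have := leq_trans (count_size [predC z.2] V) V_m.
  by have := geq_minr v (count [predC z.2] V); lia.
have le_ps' : size ps' <= size ps by rewrite ps_eq.
have : size ps' * (m * m.+2 + m + 2).+1 <= size ps * (m * m.+2 + m + 3).
  by rewrite leq_mul // -addnS.
rewrite [size (g :: n)]/= mulSn; move: (size n * _) => a.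
rewrite /iteration_cost; move: (size ps * _) => b; move: (size ps' * _) => c.
by move: (m * m.+2) => d; lia.
Qed.

Lemma time_greedy fs : size fs <= m ->
  time (greedy fs ps) <= greedy_cost m (size ps).
Proof.
rewrite /greedy_cost.
have [/size0nil->|fs_gt0] := posnP (size fs); first by rewrite addn1.
case ps_eq: ps => [|x ps'] fs_m; first by case: (fs) => *; rewrite addn1.
rewrite greedy_cons // -ps_eq !timedE; set y := result (select _ _ _ _ _).
have x_ps : x \in ps by rewrite ps_eq mem_head.
have y_ps : y \in ps by rewrite ps_eq select_mem.
have := time_greedy_loop fs (ps_m y_ps).
have : size fs * (iteration_cost m (size ps)).+1
       <= m * (iteration_cost m (size ps)).+1 by rewrite leq_mul.
have : time (select (@size_timed F) ltn_timed x (result (size_timed x.2)) ps')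
       <= size ps' * ((m.+1).*2).+1 + 1.
  apply: time_select => z z_ps' v.
  have z_ps : z \in ps by rewrite ps_eq inE z_ps' orbT.
  rewrite time_size_timed result_size_timed time_ltn_timed.
  by have := ps_m z_ps; have := geq_minl (size z.2) v; lia.
have le_ps' : size ps' <= size ps by rewrite ps_eq.
have : size ps' * ((m.+1).*2).+1 <= size ps * ((m.+1).*2).+1 by rewrite leq_mul.
rewrite time_size_timed; have := ps_m x_ps.
move: (iteration_cost _ _) => ic.
move: (size ps' * _) (size ps * _) => a b; move: (size fs * _) (m * ic.+1) => c d.
by move: (time (select _ _ _ _ _)) (time (greedy_loop _ _ _)) (size x.2); lia.
Qed.

End Time.

(** * Correctness of the algorithm *)

Section Correctness.

Variables (I : instance) (K : nat) (P : seq (seq I)).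
Variables (fs : seq (fiber I)) (ps : seq (seq I * seq (fiber I))).
Hypothesis P_surv : survivable_path_set K P.
Hypothesis input : greedy_input K fs ps.

Lemma input_used x : x \in ps -> uniq x.2 /\ x.2 =i used x.1.
Proof. by case: input => _ _ _ _; apply. Qed.

Lemma input_admissible x : x \in ps -> admissible K x.1.
Proof.
move=> x_ps; case: input => _ _ _ ps_adm _.
by rewrite -[admissible _ _]/(_ \in admissible K) -ps_adm map_f.
Qed.

Lemma admissible_input p : admissible K p -> exists2 x, x \in ps & x.1 = p.
Proof.
case: input => _ _ _ ps_adm _ p_adm.
have : p \in unzip1 ps by rewrite ps_adm.
by case/mapP => x; exists x.
Qed.

Lemma input_card_used x : x \in ps -> size x.2 = #|used x.1|.
Proof.
move=> /input_used[x_uniq x_used].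
by rewrite -(card_uniqP x_uniq); apply: eq_card.
Qed.

Lemma input_size_fs : size fs = #|fibers I|.
Proof.
case: input => fs_uniq fsE _ _ _.
by rewrite -(card_uniqP fs_uniq); apply: eq_card.
Qed.

Lemma input_survives x f :
  x \in ps -> f \in fibers I -> survives x.1 f = (f \notin x.2).
Proof. by move=> /input_used[_ ->] fI; rewrite inE fI. Qed.

Lemma input_count x (U : seq (fiber I)) :
    x \in ps -> uniq U -> {subset U <= fibers I} ->
  count [predC x.2] U = #|[set f in [set f in U] | survives x.1 f]|.
Proof.
move=> x_ps U_uniq UI; rewrite -size_filter.
rewrite -(card_uniqP (filter_uniq _ U_uniq)); apply: eq_card => f.
rewrite !inE mem_filter andbC /=; have [fU|//] := boolP (f \in U).
by rewrite (input_survives x_ps) ?UI.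
Qed.

(** The list [n] is long enough: in each iteration the selected path survives at
    least as many fibers of [U] as a path of [P] that survives some fiber of [U],
    so [U] loses at least one fiber. *)
Lemma greedy_loop_rest n (U : seq (fiber I)) :
    uniq U -> {subset U <= fibers I} -> size U <= size n ->
  greedy_rest K [set f in U] (result (greedy_loop n ps U)).
Proof.
have stop n' : greedy_rest K [set f in [::]] (result (greedy_loop n' ps [::])).
  have -> : greedy_loop n' ps [::] = tick (ret [::]) by case: n'.
  by apply: GreedyStop; apply/setP => f; rewrite !inE.
elim: n U => [|g n IHn] V V_uniq VI V_n.
  by move: V_n; rewrite leqn0 => /nilP->.
have [/size0nil->//|V_gt0] := posnP (size V).
have [f fV] : exists f, f \in V.
  by case: V V_gt0 {V_uniq VI V_n} => // f V _; exists f; rewrite mem_head.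
have [q0 q0_adm q0f] : exists2 q, admissible K q & survives q f.
  by case: P_surv => _ P_adm /(_ f (VI _ fV))[q /P_adm]; exists q.
have [x0 x0_ps x0q] := admissible_input q0_adm.
case ps_eq: ps => [|x ps']; first by rewrite ps_eq in x0_ps.
rewrite greedy_loop_cons // -ps_eq !timedE; set y := result (select _ _ _ _ _).
have y_ps : y \in ps by rewrite ps_eq select_mem.
have y_best z : z \in ps -> count [predC z.2] V <= count [predC y.2] V.
  rewrite ps_eq => z_ps; rewrite -!result_count_survived.
  apply: (@select_best _ _ _ _ geq) z_ps.
  - by move=> a; apply: leqnn.
  - by move=> a b c ba cb; apply: leq_trans cb ba.
  - by move=> a b; apply: leq_total.
  - by move=> w v; rewrite result_ltn_timed ltnNge.
rewrite result_unsurvived; apply: GreedyStep.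
- by apply/set0Pn; exists f; rewrite inE.
- exact: input_admissible.
- move=> q /admissible_input[z z_ps <-].
  by rewrite -!input_count // y_best.
have -> : [set f0 in [set f1 in V] | ~~ survives y.1 f0]
          = [set h in [seq h <- V | h \in y.2]].
  apply/setP => h; rewrite !inE mem_filter andbC; have [hV|] := boolP (h \in V).
    by rewrite (input_survives y_ps) ?VI // negbK.
  by rewrite !andbF.
apply: IHn; first by rewrite filter_uniq.
  by move=> h; rewrite mem_filter => /andP[_ /VI].
have : 0 < count [predC y.2] V.
  apply: leq_trans (y_best _ x0_ps); rewrite -has_count; apply/hasP.
  by exists f; rewrite // inE /= -(input_survives x0_ps) ?VI // x0q.
move=> y_gt0; rewrite size_filter -ltnS; apply: leq_trans V_n.
by rewrite -(count_predC (mem y.2) V) -[ltnLHS]addn0 ltn_add2l.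
Qed.

Lemma greedy_is_run : greedy_run K (result (greedy fs ps)).
Proof.
case: (input) => fs_uniq fsE _ _ _.
have [/size0nil fs0|fs_gt0] := posnP (size fs).
  by rewrite fs0; apply/setP => f; rewrite -fsE fs0 inE.
have [f fI] : exists f, f \in fibers I.
  by case fs_eq: fs fs_gt0 => [//|f fs'] _; exists f; rewrite -fsE fs_eq mem_head.
have [q0 q0_adm] : exists q : seq I, admissible K q.
  by case: P_surv => _ P_adm /(_ f fI)[q qP _]; exists q; apply: P_adm.
have [x0 x0_ps _] := admissible_input q0_adm.
case ps_eq: ps => [|x ps']; first by rewrite ps_eq in x0_ps.
rewrite greedy_cons // -ps_eq !timedE; set y := result (select _ _ _ _ _).
have y_ps : y \in ps by rewrite ps_eq select_mem.
have [y_uniq y_used] := input_used y_ps.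
split.
- by apply/set0Pn; exists f.
- exact: input_admissible.
- move=> q /admissible_input[z z_ps <-]; rewrite -!input_card_used //.
  rewrite -!result_size_timed; rewrite ps_eq in z_ps.
  apply: (@select_best _ _ _ _ leq) z_ps.
  - exact: leqnn.
  - exact: leq_trans.
  - exact: leq_total.
  - by move=> w v; rewrite result_ltn_timed ltnNge.
have -> : used y.1 = [set h in y.2] by apply/setP => h; rewrite [in RHS]inE y_used.
apply: greedy_loop_rest => // [h|].
  by rewrite y_used => /(subsetP (used_sub _)).
by rewrite (input_card_used y_ps) input_size_fs subset_leq_card ?used_sub.
Qed.

Lemma greedy_time :
  time (greedy fs ps)
    <= greedy_cost #|fibers I| ((2 * #|fibers I|).+1 ^ (2 * K)).
Proof.
set m := #|fibers I|; set N := _ ^ _.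
have ps_m x : x \in ps -> size x.2 <= m.
  by move=> x_ps; rewrite input_card_used // subset_leq_card ?used_sub.
have ps_N : size ps <= N.
  rewrite -(size_map fst); case: input => _ _ ps_uniq ps_adm _.
  by apply: count_admissible => // p; rewrite ps_adm.
apply: leq_trans (time_greedy ps_m _) _; first by rewrite input_size_fs.
by rewrite /greedy_cost /iteration_cost !(leq_add, leq_mul, ltnS).
Qed.

End Correctness.

Local Open Scope ring_scope.

Theorem theorem3 (R : realType) :
  exists2 c : R, 0 < c &
  forall K : nat, (2 <= K)%N ->
  exists q : {poly nat},
  forall (I : instance) (xi : nat), min_survivable_size I K xi ->
    (forall sel : seq (seq I), greedy_run K sel ->
       survivable_path_set K sel /\
       (size sel)%:R <= c * ln K%:R * xi%:R) /\
    (forall (fs : seq (fiber I)) (ps : seq (seq I * seq (fiber I))),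
       greedy_input K fs ps ->
       greedy_run K (result (greedy fs ps)) /\
       (time (greedy fs ps) <= q.[#|fibers I|])%N).
Proof.
have ln2 : 0 < ln 2 :> R by rewrite ln_gt0 // ltr1n.
exists (1 + 2 / ln 2); first by rewrite addr_gt0 // divr_gt0.
move=> K K2.
(* [q] mirrors [greedy_cost], with [N] for the number of admissible paths. *)
pose C (k : nat) : {poly nat} := k%:P.
pose N := (C 2%N * 'X + C 1%N) ^+ (2 * K).
pose scan := 'X * ('X + C 2%N) + C 1%N.
pose iteration := C 2%N * scan + (N * (scan + 'X + C 2%N) + C 1%N).
exists (C 2%N * ('X + C 1%N) + (N * (C 2%N * ('X + C 1%N) + C 1%N) + C 1%N)
        + ('X * (iteration + C 1%N) + C 1%N) + C 1%N).
move=> I xi [[P P_surv <-] _]; split=> [sel run|fs ps input].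
  by split; [exact: greedy_run_sound P_surv run | exact: greedy_run_size].
split; first exact: greedy_is_run P_surv input.
apply: leq_trans (greedy_time input) _.
rewrite /iteration /scan /N !(hornerD, hornerM, horner_exp, hornerX, hornerC).
rewrite !(ssralg.natrDE, ssralg.natrME, ssralg.natrXE).
rewrite /greedy_cost /iteration_cost !addn1 !addn2 !mul2n.
lia.
Qed.
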